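(* Let $\Omega$ be a smooth bounded domain, $N\ge1$, $\tau>0$, and let $a^{1},\dots,a^{N}$ be smooth functions on $\Omega$ satisfying $0<a<a^{k+1}<b<+\infty$ for $0\le k\le N-1$, where $a,b$ are constants. Let $p\in\,]1,\infty[$ satisfy $$\frac{b-a}{2}K_{\frac{a+b}{2},p}<1,$$ where $K_{m,p}$ is the constant defined in the context, and let $F=(F^1,\dots,F^N)$ with $F^k\in L^p(\Omega)$. Let $(\Psi^k)_{0\le k\le N}$ be a solution of $$\frac{\Psi^{k+1}-\Psi^k}{\tau}+a^{k+1}\Delta\Psi^k=F^{k+1}\ (0\le k\le N-1),\qquad \Psi^N=0,\qquad \partial_n\Psi^k=0\ \text{on }\partial\Omega.$$ Then $$\Big(\sum_{k=0}^{N-1}\tau\|\Delta\Psi^k\|_{L^p(\Omega)}^p\Big)^{1/p}\le\bar D_{a,b,p}\Big(\sum_{k=0}^{N-1}\tau\|F^{k+1}\|_{L^p(\Omega)}^p\Big)^{1/p}$$ and $$\|\Psi^0\|_{L^p(\Omega)}\le\big(1+b\bar D_{a,b,p}\big)(N\tau)^{1/p'}\Big(\sum_{k=0}^{N-1}\tau\|F^{k+1}\|_{L^p(\Omega)}^p\Big)^{1/p},$$ where $\frac1p+\frac1{p'}=1$ and $$\bar D_{a,b,p}=\frac{K_{\frac{a+b}{2},p}}{1-\frac{b-a}{2}K_{\frac{a+b}{2},p}}.$$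
   Context: $\partial_n$ is the normal derivative on $\partial\Omega$. For $m>0$ and $p\in\,]1,\infty[$, $K_{m,p}$ denotes the best constant (depending only on $\Omega,p,m$, and not on $\tau>0$ or $N\ge1$) such that for all $\tau>0$, $N\ge 1$ and $F=(F^1,\dots,F^N)$ with $F^k\in L^p(\Omega)$, the solution $(\Psi^k)_{0\le k\le N}$ of $$\frac{\Psi^{k+1}-\Psi^k}{\tau}+m\Delta\Psi^k=F^{k+1}\ (0\le k\le N-1),\qquad \Psi^N=0,\qquad \partial_n\Psi^k=0\ \text{on }\partial\Omega,$$ satisfies $$\Big(\sum_{k=0}^{N-1}\tau\|\Delta\Psi^k\|_{L^p(\Omega)}^p\Big)^{1/p}\le K_{m,p}\Big(\sum_{k=0}^{N-1}\tau\|F^{k+1}\|_{L^p(\Omega)}^p\Big)^{1/p}.$$ Such a finite constant exists (discrete maximal regularity). *)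

(* Defs.v *)
From HB Require Import structures.
From mathcomp Require Import all_boot all_order all_algebra.
From mathcomp Require Import all_classical all_reals all_analysis.
Import Order.TTheory GRing.Theory Num.Theory.
Import numFieldNormedType.Exports.

Set Implicit Arguments.
Unset Strict Implicit.
Unset Printing Implicit Defensive.

Local Open Scope classical_set_scope.
Local Open Scope ring_scope.

(* The library's [mu_ext] turns a set function into an outer measure by
   countable coverings, but only by sets that are measurable for some ambient
   structure on the type.  On this copy of [T] every set is allowed. *)
Definition all_sets (T : Type) : Type := T.

HB.instance Definition _ (T : pointedType) := Pointed.on (all_sets T).
HB.instance Definition _ (T : pointedType) :=
  @isMeasurable.Build default_measure_display (all_sets T)
    discrete_measurable discrete_measurable0
    discrete_measurableC discrete_measurableU.

Section lebesgue.
Context (R : realType) (d : nat).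
Local Notation E := 'rV[R]_d.+1.
Local Open Scope ereal_scope.

(* Volume of the smallest closed box containing [A] (+oo if there is none).
   Covering by arbitrary sets weighted by [box_volume] is the same as covering
   by boxes weighted by their volume, so [lebesgue_outer] is the usual Lebesgue
   outer measure. *)
Definition box_volume (A : set E) : \bar R :=
  ereal_inf [set (\prod_i (ab.2 ord0 i - ab.1 ord0 i))%:E | ab in
    [set ab : E * E | (forall i, (ab.1 ord0 i <= ab.2 ord0 i)%R) /\
      A `<=` [set x | forall i, x ord0 i \in `[ab.1 ord0 i, ab.2 ord0 i]]]].

Lemma box_volume_ge0 A : 0 <= box_volume A.
Proof.
apply: le_ereal_inf_tmp => _ [[a b] [/= ab _] <-].
by rewrite lee_fin; apply: prodr_ge0 => i _; rewrite subr_ge0.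
Qed.

Lemma box_volume0 : box_volume set0 = 0.
Proof.
apply/eqP; rewrite eq_le box_volume_ge0 andbT; apply: ereal_inf_lbound.
exists (0%R, 0%R); first by split.
by congr EFin; rewrite (bigD1 ord0)//= subrr mul0r.
Qed.

Definition lebesgue_outer : set E -> \bar R :=
  @mu_ext default_measure_display (all_sets E) R box_volume.

HB.instance Definition _ := isOuterMeasure.Build R E lebesgue_outer
  (@mu_ext0 _ (all_sets E) R _ box_volume0 box_volume_ge0)
  (@mu_ext_ge0 _ (all_sets E) R _ box_volume_ge0)
  (@le_mu_ext _ (all_sets E) R _)
  (@mu_ext_sigma_subadditive _ (all_sets E) R _ box_volume_ge0).

Definition lebesgue_outer_measure : {outer_measure set E -> \bar R} :=
  lebesgue_outer.

(* R^(d+1) with the sigma-algebra of Lebesgue measurable sets. *)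
Definition lebesgue_space : Type := caratheodory_type lebesgue_outer_measure.
HB.instance Definition _ := Measurable.on lebesgue_space.

Definition lebesgueN : {measure set lebesgue_space -> \bar R} :=
  (lebesgue_outer_measure : set (caratheodory_type lebesgue_outer_measure) -> \bar R).

End lebesgue.
Arguments lebesgueN {R d}.

Section surface_measure.
Context (R : realType) (d : nat).
Local Notation E := 'rV[R]_d.+1.

(* The norm of the library on row vectors is the sup norm. *)
Definition euclid_norm (x : E) : R := Num.sqrt (\sum_i x ord0 i ^+ 2).

Local Open Scope ereal_scope.

Definition diameter (A : set E) : \bar R :=
  ereal_sup [set (euclid_norm (xy.1 - xy.2)%R)%:E | xy in A `*` A].

(* The ambient dimension is d + 1, so hypersurfaces have dimension d. *)
Definition hausdorff_weight (delta : R) (A : set E) : \bar R :=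
  if A == set0 then 0 else
  if diameter A <= delta%:E then diameter A ^+ d else +oo.

Lemma hausdorff_weight0 delta : hausdorff_weight delta set0 = 0.
Proof. by rewrite /hausdorff_weight eqxx. Qed.

Lemma diameter_ge0 A : A !=set0 -> 0 <= diameter A.
Proof.
move=> [x Ax]; apply: ereal_sup_ge; exists (0%R)%:E => //.
exists (x, x) => //=; congr EFin; rewrite /euclid_norm subrr big1 ?sqrtr0//.
by move=> i _; rewrite mxE expr0n.
Qed.

Lemma hausdorff_weight_ge0 delta A : 0 <= hausdorff_weight delta A.
Proof.
rewrite /hausdorff_weight; case: eqVneq => // /set0P A0.
by case: ifP => // _; apply: expe_ge0; exact: diameter_ge0.
Qed.

Definition hausdorff_premeasure (delta : R) : set E -> \bar R :=
  @mu_ext default_measure_display (all_sets E) R (hausdorff_weight delta).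

(* d-dimensional Hausdorff measure.  The customary normalizing constant is
   omitted: it affects neither null sets nor convergence in L^p. *)
Definition hausdorff_outer (A : set E) : \bar R :=
  ereal_sup [set hausdorff_premeasure delta A | delta in [set r : R | (0 < r)%R]].

Lemma hausdorff_premeasure_le delta A :
  (0 < delta)%R -> hausdorff_premeasure delta A <= hausdorff_outer A.
Proof. by move=> d0; apply: ereal_sup_ubound; exists delta. Qed.

Lemma hausdorff_outer_ge0 A : 0 <= hausdorff_outer A.
Proof.
apply: le_trans (hausdorff_premeasure_le A (@ltr01 R)).
exact: (@mu_ext_ge0 _ (all_sets E) R _ (hausdorff_weight_ge0 1)).
Qed.

Lemma hausdorff_outer0 : hausdorff_outer set0 = 0.
Proof.
apply/eqP; rewrite eq_le hausdorff_outer_ge0 andbT.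
apply: ge_ereal_sup => _ [delta _ <-].
by rewrite /hausdorff_premeasure (@mu_ext0 _ (all_sets E) R _
  (hausdorff_weight0 delta) (hausdorff_weight_ge0 delta)).
Qed.

Lemma le_hausdorff_outer : {homo hausdorff_outer : A B / A `<=` B >-> A <= B}.
Proof.
move=> A B AB; apply: ge_ereal_sup => _ [delta d0 <-].
apply: le_trans (hausdorff_premeasure_le B d0).
exact: (@le_mu_ext _ (all_sets E) R).
Qed.

Lemma hausdorff_outer_sigma_subadditive : sigma_subadditive hausdorff_outer.
Proof.
move=> F; apply: ge_ereal_sup => _ [delta d0 <-].
apply: (le_trans (@mu_ext_sigma_subadditive _ (all_sets E) R _
  (hausdorff_weight_ge0 delta) F)).
apply: lee_nneseries => n _ *; last exact: hausdorff_premeasure_le.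
exact: (@mu_ext_ge0 _ (all_sets E) R _ (hausdorff_weight_ge0 delta)).
Qed.

HB.instance Definition _ := isOuterMeasure.Build R E hausdorff_outer
  hausdorff_outer0 hausdorff_outer_ge0 le_hausdorff_outer
  hausdorff_outer_sigma_subadditive.

Definition hausdorff_outer_measure : {outer_measure set E -> \bar R} :=
  hausdorff_outer.

Definition surface_space : Type := caratheodory_type hausdorff_outer_measure.
HB.instance Definition _ := Measurable.on surface_space.

Definition surface_measure : {measure set surface_space -> \bar R} :=
  (hausdorff_outer_measure : set (caratheodory_type hausdorff_outer_measure) -> \bar R).

End surface_measure.
Arguments surface_measure {R d}.

Section smoothness.
Context (R : realType) (d : nat).
Local Notation E := 'rV[R]_d.+1.

Definition basis (i : 'I_d.+1) : E := delta_mx ord0 i.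

Fixpoint Ck (k : nat) (U : set E) (f : E -> R) : Prop :=
  (forall x, U x -> {for x, continuous f}) /\
  if k is k'.+1 then
    forall i, (forall x, U x -> derivable f x (basis i)) /\
              Ck k' U ('D_(basis i) f)
  else True.

Definition smooth_on (U : set E) (f : E -> R) : Prop := forall k, Ck k U f.

Definition gradient (f : E -> R) (x : E) : E :=
  \row_i 'D_(basis i) f x.

Definition boundary (Om : set E) : set E := closure Om `\` Om°.

(* Near [x], [Om] is the side [rho < 0] of the regular hypersurface
   [rho = 0]. *)
Definition defining_function (Om : set E) (x : E) (U : set E) (rho : E -> R) :=
  [/\ open U, U x, smooth_on U rho, (forall y, U y -> gradient rho y != 0) &
      Om `&` U = [set y | U y /\ rho y < 0]].

Definition smooth_bounded_domain (Om : set E) : Prop :=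
  [/\ open Om, connected Om, Om !=set0, bounded_set Om &
      forall x, boundary Om x -> exists U rho, defining_function Om x U rho].

Definition is_outward_normal (Om : set E) (x n : E) : Prop :=
  exists U rho, defining_function Om x U rho /\
    n = (euclid_norm (gradient rho x))^-1 *: gradient rho x.

Definition outward_normal (Om : set E) (x : E) : E :=
  xget 0 [set n | is_outward_normal Om x n].

End smoothness.

Section sobolev.
Context (R : realType) (d : nat).
Local Notation E := 'rV[R]_d.+1.
Implicit Types (Om : set E) (p : R) (u g : E -> R).

(* Functions are total on R^(d+1); only their values on [Om] matter, hence the
   extension by zero [u \_ Om]. *)
Definition in_Lp Om p u : Prop :=
  (u \_ Om : lebesgue_space R d -> R)
    \in Lfun lebesgueN p%:E.

Definition Lp_norm Om p u : \bar R := ('N[lebesgueN]_p%:E[EFin \o (u \_ Om)])%E.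

Definition locally_integrable_on Om u : Prop :=
  forall K : set E, compact K -> K `<=` Om ->
    lebesgueN.-integrable K (EFin \o u).

Definition test_function Om (phi : E -> R) : Prop :=
  smooth_on setT phi /\
  exists K : set E, [/\ compact K, K `<=` Om & forall x, ~ K x -> phi x = 0].

Definition is_weak_partial Om (i : 'I_d.+1) u g : Prop :=
  [/\ locally_integrable_on Om u, locally_integrable_on Om g &
      forall phi, test_function Om phi ->
        \int[lebesgueN]_(x in Om) (u x * 'D_(basis R i) phi x) =
        - \int[lebesgueN]_(x in Om) (g x * phi x)].

Definition weakly_differentiable Om i u : Prop :=
  exists g, is_weak_partial Om i u g.

(* A representative of the weak derivative, which is unique up to a.e.
   equality on [Om]; a junk value if [u] is not weakly differentiable. *)
Definition weak_partial Om i u : E -> R :=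
  xget (fun=> 0) [set g | is_weak_partial Om i u g].

Fixpoint in_Wkp (k : nat) Om p u : Prop :=
  in_Lp Om p u /\
  if k is k'.+1 then
    forall i, weakly_differentiable Om i u /\ in_Wkp k' Om p (weak_partial Om i u)
  else True.

Definition laplacian Om u : E -> R :=
  fun x => \sum_i weak_partial Om i (weak_partial Om i u) x.

Definition in_boundary_Lp Om p g : Prop :=
  (g \_ (boundary Om) : surface_space R d -> R)
    \in Lfun surface_measure p%:E.

Definition boundary_Lp_norm Om p g : \bar R :=
  ('N[surface_measure]_p%:E[EFin \o (g \_ (boundary Om))])%E.

(* The trace is the continuous extension to W^{1,p} of the restriction to the
   boundary, defined on functions smooth up to the boundary. *)
Definition is_trace Om p u g : Prop :=
  exists v : nat -> E -> R,
    [/\ forall j, smooth_on setT (v j),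
        Lp_norm Om p (v j \- u) @[j --> \oo] --> 0%E,
        forall i, Lp_norm Om p ('D_(basis R i) (v j) \- weak_partial Om i u)
          @[j --> \oo] --> 0%E,
        in_boundary_Lp Om p g &
        boundary_Lp_norm Om p (v j \- g) @[j --> \oo] --> 0%E].

Definition is_normal_derivative Om p u h : Prop :=
  exists g : 'I_d.+1 -> E -> R,
    (forall i, is_trace Om p (weak_partial Om i u) (g i)) /\
    {ae surface_measure, forall x, boundary Om x ->
      h x = \sum_i outward_normal Om x ord0 i * g i x}.

End sobolev.

Section discrete_parabolic.
Context (R : realType) (d : nat).
Local Notation E := 'rV[R]_d.+1.
Implicit Types (Om : set E) (p tau m : R) (N : nat).

(* [a], [F] are only used at the indices 1, ..., N. *)
Definition is_solution Om p (a : nat -> E -> R) tau N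
    (F Psi : nat -> E -> R) : Prop :=
  [/\ forall k, (k <= N)%N -> in_Wkp 2 Om p (Psi k),
      forall k, (k < N)%N ->
        {ae lebesgueN, forall x, Om x ->
          (Psi k.+1 x - Psi k x) / tau + a k.+1 x * laplacian Om (Psi k) x
          = F k.+1 x},
      {ae lebesgueN, forall x, Om x -> Psi N x = 0} &
      forall k, (k <= N)%N -> is_normal_derivative Om p (Psi k) (fun=> 0)].

Local Open Scope ereal_scope.

Definition discrete_LpLp_norm Om p tau N (G : nat -> E -> R) : \bar R :=
  (\sum_(k < N) tau%:E * Lp_norm Om p (G k) `^ p) `^ p^-1.

Definition maximal_regularity_bound Om p m (C : R) : Prop :=
  forall tau N (F Psi : nat -> E -> R), (0 < tau)%R -> (1 <= N)%N ->
    (forall k, (k < N)%N -> in_Lp Om p (F k.+1)) ->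
    is_solution Om p (fun _ _ => m) tau N F Psi ->
    discrete_LpLp_norm Om p tau N (fun k => laplacian Om (Psi k)) <=
      C%:E * discrete_LpLp_norm Om p tau N (fun k => F k.+1).

(* The best constant, as an extended real: [+oo] if there is none. *)
Definition Kconst Om p m : \bar R :=
  ereal_inf [set C%:E | C in
    [set C : R | (0 <= C)%R /\ maximal_regularity_bound Om p m C]].

Definition Dbar Om (a b : R) p : R :=
  let K := fine (Kconst Om p ((a + b) / 2)%R) in
  (K / (1 - (b - a) / 2 * K))%R.

End discrete_parabolic.

(* Main.v *)
(* Let m = (a+b)/2. The functions Psi solve the constant coefficient problem with
   source G^{k+1} = (Psi^{k+1} - Psi^k)/tau + m Delta Psi^k, and
   |G^{k+1} - F^{k+1}| = |m - a^{k+1}| |Delta Psi^k| <= (b-a)/2 |Delta Psi^k|.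
   With X the norm of Delta Psi and Y that of F, this gives
   X <= K (Y + (b-a)/2 X), and the last term is absorbed on the left.
   The bound on Psi^0 follows by summing
   |Psi^k - Psi^{k+1}| <= tau (|F^{k+1}| + b |Delta Psi^k|) and Hoelder in k. *)
Require Import Defs.
From mathcomp Require Import all_boot all_order all_algebra.
From mathcomp Require Import all_classical all_reals all_analysis.
From mathcomp Require Import measurable_realfun.
From mathcomp Require Import ring lra.
Import Order.TTheory GRing.Theory Num.Theory.
Import numFieldNormedType.Exports.
Local Open Scope classical_set_scope.
Local Open Scope ring_scope.

(** * Weighted l^p norms of finite sequences *)

Section sequence_norm.
Context {R : realType} (N : nat).
Implicit Types (x y : nat -> R) (p q tau : R).

(** Extending by zero from index [N] on makes finite sums integrals against [counting], so that
    Minkowski and Hoelder can be quoted; the tail vanishes because [p] is nonzero. *)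
Lemma Lnorm_counting_finite p x : 0 < p ->
  (forall k, (k < N)%N -> 0 <= x k) ->
  ('N[@counting nat R]_p%:E[EFin \o (fun k => if (k < N)%N then x k else 0%R)])%E =
  ((\sum_(k < N) x k `^ p) `^ p^-1)%:E.
Proof.
move=> p0 x0; rewrite Lnorm_counting//.
rewrite (nneseries_split 0 N); last by move=> k _; exact: poweR_ge0.
rewrite add0n ereal_series_cond eseries0 ?adde0; last first.
  by move=> k _; rewrite andbT => /= /leq_gtF ->; rewrite normr0 powR0 ?gt_eqF.
rewrite big_mkord -poweR_EFin -sumEFin; congr (_ `^ _)%E.
by apply: eq_bigr => k _; rewrite /= ltn_ord ger0_norm ?x0.
Qed.

(** Real-valued counterpart of [discrete_LpLp_norm], with [x k] standing for the spatial norm at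
    time step [k]. *)
Definition weighted_norm p tau x : R := (\sum_(k < N) tau * x k `^ p) `^ p^-1.

Lemma weighted_norm_scale p tau x : 0 < p -> 0 < tau ->
  weighted_norm p tau x = tau `^ p^-1 * (\sum_(k < N) x k `^ p) `^ p^-1.
Proof.
move=> p0 t0; rewrite /weighted_norm -mulr_sumr powRM ?(ltW t0)//.
by apply: sumr_ge0 => k _; exact: powR_ge0.
Qed.

Lemma weighted_norm_le p tau x y : 0 < p -> 0 < tau ->
  (forall k, (k < N)%N -> 0 <= x k <= y k) ->
  weighted_norm p tau x <= weighted_norm p tau y.
Proof.
move=> p0 t0 xy; apply: ge0_ler_powR; rewrite ?invr_ge0 ?(ltW p0)// ?nnegrE.
- by apply: sumr_ge0 => k _; rewrite mulr_ge0 ?powR_ge0 ?(ltW t0).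
- by apply: sumr_ge0 => k _; rewrite mulr_ge0 ?powR_ge0 ?(ltW t0).
apply: ler_sum => k _; rewrite ler_pM2l//.
have /andP[x0 xyk] := xy k (ltn_ord k).
by apply: ge0_ler_powR; rewrite ?(ltW p0)// nnegrE (le_trans x0).
Qed.

Lemma weighted_normZ p tau c x : 0 < p -> 0 < tau -> 0 <= c ->
  (forall k, (k < N)%N -> 0 <= x k) ->
  weighted_norm p tau (fun k => c * x k) = c * weighted_norm p tau x.
Proof.
move=> p0 t0 c0 x0; rewrite !weighted_norm_scale// mulrCA; congr (_ * _).
under eq_bigr => k _ do rewrite powRM ?x0//.
rewrite -mulr_sumr powRM ?powR_ge0//; last by apply: sumr_ge0 => k _; exact: powR_ge0.
by rewrite -powRrM mulfV ?gt_eqF// powRr1.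
Qed.

Lemma weighted_normD p tau x y : 1 <= p -> 0 < tau ->
  (forall k, (k < N)%N -> 0 <= x k) -> (forall k, (k < N)%N -> 0 <= y k) ->
  weighted_norm p tau (fun k => x k + y k) <=
  weighted_norm p tau x + weighted_norm p tau y.
Proof.
move=> p1 t0 x0 y0; have p0 : 0 < p := lt_le_trans ltr01 p1.
rewrite !weighted_norm_scale// -mulrDr ler_pM2l ?powR_gt0//.
pose tr z k : R := if (k < N)%N then z k else 0.
have := @minkowski_EFin _ _ R counting (tr x) (tr y) p.
have -> : (tr x \+ tr y)%R = tr (fun k => x k + y k).
  by apply/funext => k; rewrite /tr/=; case: ifP => //; rewrite addr0.
rewrite !Lnorm_counting_finite// => [|k kN]; last by rewrite addr_ge0 ?x0 ?y0.
rewrite -EFinD lee_fin; apply => //.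
Qed.

Lemma sum_le_weighted_norm p q tau x : 0 < p -> 0 < q -> p^-1 + q^-1 = 1 ->
  0 < tau -> (forall k, (k < N)%N -> 0 <= x k) ->
  \sum_(k < N) tau * x k <= (N%:R * tau) `^ q^-1 * weighted_norm p tau x.
Proof.
move=> p0 q0 pq t0 x0.
(* The second factor is the indicator of the first [N] indices, whose l^q norm is N^(1/q). *)
have /= := @hoelder _ _ R counting (fun k => if (k < N)%N then x k else 0)
  (fun k => if (k < N)%N then 1 else 0) p q.
set fg := (X in (Lnorm _ _ (EFin \o X))).
have -> : fg = (fun k => if (k < N)%N then x k else 0).
  by apply/funext => k; rewrite /fg/=; case: ifP; rewrite ?mulr1 ?mulr0.
rewrite !Lnorm_counting_finite// -EFinM lee_fin invr1.
move=> /(_ (fun _ _ _ => I) (fun _ _ _ => I) p0 q0 pq).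
under [X in _ <= _ * X `^ _]eq_bigr => k _ do rewrite powR1.
under [X in X `^ _ <= _]eq_bigr => k _ do rewrite powRr1 ?x0//.
rewrite sumr_const card_ord powRr1 => [H|]; last by apply: sumr_ge0 => k _; rewrite x0.
(* One factor joins N^(1/q), the other is the weight inside [weighted_norm]. *)
have tau_split : tau = tau `^ q^-1 * tau `^ p^-1.
  by rewrite -powRD ?(gt_eqF t0) ?implybT// addrC pq powRr1// ltW.
rewrite -mulr_sumr weighted_norm_scale// powRM ?(ltW t0)//.
rewrite -mulrA (mulrA (tau `^ q^-1)) -tau_split mulrCA ler_pM2l//.
by rewrite mulrC.
Qed.

End sequence_norm.

(** * Spatial L^p norms *)

Lemma ae_le_Lnorm {dT} {T : measurableType dT} {R : realType}
    (mu : {measure set T -> \bar R}) (p c : R) (f g : T -> R) :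
  0 < p -> 0 <= c -> measurable_fun setT f -> measurable_fun setT g ->
  {ae mu, forall x, `|f x| <= c * `|g x|} ->
  ('N[mu]_p%:E[EFin \o f] <= c%:E * 'N[mu]_p%:E[EFin \o g])%E.
Proof.
move=> p0 c0 mf mg fg.
have mpow (h : T -> R) : measurable_fun setT h ->
    measurable_fun setT (EFin \o (fun x => `|h x| `^ p)).
  move=> mh; apply/measurable_EFinP.
  by apply: (measurableT_comp (measurable_powR _)) => //; exact: measurableT_comp.
have int0 (h : T -> R) : (0 <= \int[mu]_x (`|(EFin \o h) x| `^ p))%E.
  by apply: integral_ge0 => x _; exact: poweR_ge0.
rewrite unlock /=.
(* In this form the constant goes under the root and then into the integral as c^p, which leaves an
   a.e. comparison of integrands. *)
have -> : c%:E = ((c%:E `^ p) `^ p^-1)%E.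
  by rewrite -poweRrM mulfV ?gt_eqF// poweRe1.
rewrite -poweRM ?poweR_ge0//; last exact: int0.
apply: gt0_ler_poweR; rewrite ?in_itv/= ?leey ?andbT ?invr_ge0 ?(ltW p0)//.
- exact: int0.
- by apply: mule_ge0; [rewrite lee_fin powR_ge0|exact: int0].
rewrite -ge0_integralZl_EFin ?powR_ge0//; last exact: mpow.
apply: ae_ge0_le_integral => //.
- exact: mpow.
- by move=> x _; rewrite mule_ge0 ?lee_fin ?powR_ge0.
- by apply: emeasurable_funM => //; exact: mpow.
apply: filterS fg => x fgx _; rewrite -EFinM lee_fin -powRM//.
by apply: ge0_ler_powR; rewrite ?(ltW p0)// ?nnegrE ?mulr_ge0.
Qed.

#[local] Instance ae_filter_lebesgueN {R : realType} {d : nat} :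
  Filter (nbhs (almost_everywhere (@lebesgueN R d))).
Proof. exact: (@ae_filter_ringOfSetsType _ (lebesgue_space R d)). Qed.

Section Lp.
Context {R : realType} {d : nat} (Om : set 'rV[R]_d.+1) {p : R} (p1 : 1 <= p).
Local Notation E := 'rV[R]_d.+1.
Implicit Types (u v : E -> R) (c : R).

Let p0 : 0 < p. Proof. exact: lt_le_trans p1. Qed.

Lemma restrict_comb c u v :
  (fun x => c * u x + v x) \_ Om = (fun x => c * (u \_ Om) x + (v \_ Om) x).
Proof.
apply/funext => x; rewrite !patchE; case: ifP => // _.
by rewrite mulr0 addr0.
Qed.

(** Extension by zero is linear, and [Lfun] is a submodule for 1 <= p; the shape c u + v is that of
    its closure property. *)
Lemma in_Lp_comb c {u v} : in_Lp Om p u -> in_Lp Om p v ->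
  in_Lp Om p (fun x => c * u x + v x).
Proof.
move=> uLp vLp; rewrite /in_Lp restrict_comb.
have [_] := @Lfun_submod_closed _ _ _ (@lebesgueN R d) p%:E p1; exact.
Qed.

Lemma in_Lp0 : in_Lp Om p (fun=> 0).
Proof.
rewrite /in_Lp (_ : _ \_ Om = (0 : E -> R)); last first.
  by apply/funext => x; rewrite patchE; case: ifP.
by have [] := @Lfun_submod_closed _ _ _ (@lebesgueN R d) p%:E p1.
Qed.

Lemma in_LpD {u v} : in_Lp Om p u -> in_Lp Om p v ->
  in_Lp Om p (fun x => u x + v x).
Proof.
move=> uLp vLp; have := in_Lp_comb 1 uLp vLp.
by congr in_Lp; apply/funext => x; rewrite mul1r.
Qed.

Lemma in_LpZ c {u} : in_Lp Om p u -> in_Lp Om p (fun x => c * u x).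
Proof.
move=> uLp; have := in_Lp_comb c uLp in_Lp0.
by congr in_Lp; apply/funext => x; rewrite addr0.
Qed.

Lemma in_Lp_sum {I : Type} (r : seq I) {f : I -> E -> R} :
  (forall i, in_Lp Om p (f i)) -> in_Lp Om p (fun x => \sum_(i <- r) f i x).
Proof.
move=> fLp; elim: r => [|i r ih].
  by have := in_Lp0; congr in_Lp; apply/funext => x; rewrite big_nil.
have := in_LpD (fLp i) ih.
by congr in_Lp; apply/funext => x; rewrite big_cons.
Qed.

(** Since [fine] sends +oo to 0, this is the true norm only where it is finite, in particular for
    [u] in L^p. *)
Definition rnorm u : R := fine (Lp_norm Om p u).

Lemma rnorm_ge0 u : 0 <= rnorm u.
Proof. by rewrite fine_ge0// Lnorm_ge0. Qed.

Lemma rnormE u : in_Lp Om p u -> Lp_norm Om p u = (rnorm u)%:E.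
Proof.
move=> /andP[_]; rewrite inE/= => ufin.
by rewrite fineK// ge0_fin_numE// Lnorm_ge0.
Qed.

Lemma rnormD u v : in_Lp Om p u -> in_Lp Om p v ->
  rnorm (fun x => u x + v x) <= rnorm u + rnorm v.
Proof.
move=> uLp vLp; rewrite -lee_fin EFinD -!rnormE//; last exact: in_LpD.
have -> : Lp_norm Om p (fun x => u x + v x) =
    ('N[@lebesgueN R d]_p%:E[EFin \o ((u \_ Om) \+ (v \_ Om))%R])%E.
  rewrite /Lp_norm; congr Lnorm; apply/funext => x /=.
  by rewrite !patchE; case: ifP => //; rewrite addr0.
move: uLp vLp => /andP[+ _] /andP[+ _]; rewrite !inE/= => mu mv.
exact: minkowski_EFin.
Qed.

Lemma le_rnorm c u v : 0 <= c -> in_Lp Om p u -> in_Lp Om p v ->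
  {ae @lebesgueN R d, forall x, Om x -> `|u x| <= c * `|v x|} ->
  rnorm u <= c * rnorm v.
Proof.
move=> c0 uLp vLp uv.
rewrite -lee_fin EFinM -!rnormE//.
move: uLp vLp => /andP[+ _] /andP[+ _]; rewrite !inE/= => mu mv.
apply: ae_le_Lnorm => //; apply: filterS uv => x uvx.
rewrite !patchE; case: ifPn => [/set_mem|_]; first exact: uvx.
by rewrite normr0 mulr_ge0.
Qed.

Lemma discrete_LpLp_normE tau N (G : nat -> E -> R) :
  (forall k, (k < N)%N -> in_Lp Om p (G k)) ->
  discrete_LpLp_norm Om p tau N G =
  (weighted_norm N p tau (fun k => rnorm (G k)))%:E.
Proof.
move=> GLp; rewrite /discrete_LpLp_norm /weighted_norm -poweR_EFin -sumEFin.
congr (_ `^ _)%E; apply: eq_bigr => k _.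
by rewrite rnormE//; exact: GLp (ltn_ord k).
Qed.

End Lp.
Arguments rnorm {R d} Om p u.

(** * The constant coefficient estimate with the best constant *)

Section solution.
Context {R : realType} {d : nat} {Om : set 'rV[R]_d.+1} {p : R} (p1 : 1 <= p).
Local Notation E := 'rV[R]_d.+1.
Local Notation nrm := (rnorm Om p).

Lemma in_Lp_laplacian (u : E -> R) :
  in_Wkp 2 Om p u -> in_Lp Om p (laplacian Om u).
Proof.
move=> [_ uW]; apply: (in_Lp_sum Om p1) => i.
by have [_ [_ /(_ i)[_ []]]] := uW i.
Qed.

Lemma Kconst_ge0 m : (0 <= Kconst Om p m)%E.
Proof. by apply: le_ereal_inf_tmp => _ [C [C0 _] <-]; rewrite lee_fin. Qed.

(** The infimum defining [Kconst] is itself admissible: the estimate holds for constants arbitrarily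
    close to it and passes to the limit. *)
Lemma Kconst_bound {m tau : R} {N} {F Psi : nat -> E -> R} : 0 < tau -> (1 <= N)%N ->
  Kconst Om p m \is a fin_num ->
  (forall k, (k < N)%N -> in_Lp Om p (F k.+1)) ->
  is_solution Om p (fun _ _ => m) tau N F Psi ->
  weighted_norm N p tau (fun k => nrm (laplacian Om (Psi k))) <=
  fine (Kconst Om p m) * weighted_norm N p tau (fun k => nrm (F k.+1)).
Proof.
move=> t0 N1 Kfin FLp sol.
have LLp k : (k < N)%N -> in_Lp Om p (laplacian Om (Psi k)).
  by move=> /ltnW kN; apply: in_Lp_laplacian; have [/(_ k kN)] := sol.
set X := weighted_norm _ _ _ _; set Z := weighted_norm _ _ _ _.
have bound C : maximal_regularity_bound Om p m C -> X <= C * Z.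
  move=> /(_ tau N F Psi t0 N1 FLp sol).
  by rewrite !(discrete_LpLp_normE Om) // -EFinM lee_fin.
have Z0 : 0 <= Z by exact: powR_ge0.
apply/ler_addgt0Pr => e e0.
(* With this slack in the constant the error is e Z / (Z + 1) <= e; the added 1 covers Z = 0. *)
have eZ0 : 0 < e / (Z + 1) by rewrite divr_gt0// ltr_wpDl.
have [_ [C [C0 /bound XC] <-] CK] := lb_ereal_inf_adherent eZ0 Kfin.
apply: (le_trans XC).
have CK' : C <= fine (Kconst Om p m) + e / (Z + 1).
  by rewrite -lee_fin EFinD fineK// ltW.
apply: (le_trans (ler_wpM2r Z0 CK')); rewrite mulrDl lerD2l.
by rewrite mulrAC ler_pdivrMr ?ltr_wpDl// ler_pM2l// lerDl.
Qed.

(** * Variable coefficients as a perturbation of a constant one *)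

Context {a b tau : R} {ak F Psi : nat -> E -> R} {N : nat}.
Context (a0 : 0 < a) (t0 : 0 < tau)
  (akP : forall k, (k < N)%N -> forall x, Om x -> a < ak k.+1 x < b)
  (FLp : forall k, (k < N)%N -> in_Lp Om p (F k.+1))
  (sol : is_solution Om p ak tau N F Psi).

Let X := weighted_norm N p tau (fun k => nrm (laplacian Om (Psi k))).
Let Y := weighted_norm N p tau (fun k => nrm (F k.+1)).

Let p0 : 0 < p. Proof. exact: lt_le_trans p1. Qed.

Let PsiLp {k} : (k <= N)%N -> in_Lp Om p (Psi k).
Proof. by move=> kN; have [/(_ k kN)[]] := sol. Qed.

Let LLp {k} : (k <= N)%N -> in_Lp Om p (laplacian Om (Psi k)).
Proof. by move=> kN; apply: in_Lp_laplacian; have [/(_ k kN)] := sol. Qed.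

(* Being defined from Psi alone, this lies in L^p without any appeal to the
   measurability of the coefficients [ak]. *)
Definition frozen_source (m : R) k (x : E) : R :=
  (Psi k x - Psi k.-1 x) / tau + m * laplacian Om (Psi k.-1) x.

Let source_Lp m {k} : (k < N)%N -> in_Lp Om p (frozen_source m k.+1).
Proof.
move=> kN.
have := in_LpD Om p1 (in_LpZ Om p1 tau^-1 (in_Lp_comb Om p1 (-1)
  (PsiLp (ltnW kN)) (PsiLp kN))) (in_LpZ Om p1 m (LLp (ltnW kN))).
congr in_Lp; apply/funext => x; rewrite /frozen_source; ring.
Qed.

(** The equation holds by definition of the source; regularity, terminal and boundary conditions do
    not involve the coefficients and are inherited. *)
Lemma frozen_source_solution m :
  is_solution Om p (fun _ _ => m) tau N (frozen_source m) Psi.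
Proof.
have [W _ PsiN normal] := sol; split=> // k kN.
by apply: filterE.
Qed.

(** Subtracting the two equations, the sources differ a.e. on [Om] by (m - a^{k+1}) Delta Psi^k.
    Used with m = (a+b)/2 for the Laplacian bound and with m = 0 for the time increments. *)
Lemma frozen_source_le m c k : (k < N)%N -> 0 <= c ->
  (forall x, Om x -> `|m - ak k.+1 x| <= c) ->
  nrm (frozen_source m k.+1) <= nrm (F k.+1) + c * nrm (laplacian Om (Psi k)).
Proof.
move=> kN c0 mc.
have diffLp := in_Lp_comb Om p1 (-1) (FLp _ kN) (source_Lp m kN).
have := rnormD Om p1 _ _ (FLp _ kN) diffLp.
rewrite (_ : (fun x => _) = frozen_source m k.+1); last first.
  by apply/funext => x; ring.
move=> /le_trans; apply; rewrite lerD2l.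
apply: le_rnorm => //; first exact: LLp (ltnW kN).
have [_ /(_ k kN) eqn _ _] := sol; apply: filterS eqn => x eqn Omx.
rewrite -(eqn Omx) /frozen_source /=.
rewrite (_ : _ + _ = (m - ak k.+1 x) * laplacian Om (Psi k) x); last by ring.
by rewrite normrM ler_wpM2r// mc.
Qed.

Lemma source_norm_le {c} : 0 <= c ->
  (forall k x, (k < N)%N -> Om x -> `|(a + b) / 2 - ak k.+1 x| <= c) ->
  weighted_norm N p tau
    (fun k => nrm (frozen_source ((a + b) / 2) k.+1)) <= Y + c * X.
Proof.
move=> c0 mc; set m := (a + b) / 2.
rewrite /X -weighted_normZ// => [|k kN]; last exact: rnorm_ge0.
apply: le_trans (weighted_normD _ _ _ _ _ p1 t0 _ _); last 2 first.
- by move=> k kN; exact: rnorm_ge0.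
- by move=> k kN; rewrite mulr_ge0 ?rnorm_ge0.
apply: weighted_norm_le => // k kN; rewrite rnorm_ge0/=.
by apply: frozen_source_le => // x Omx; exact: mc.
Qed.

Lemma laplacian_bound : Om !=set0 -> (1 <= N)%N ->
  (((b - a) / 2)%:E * Kconst Om p ((a + b) / 2) < 1)%E ->
  X <= Dbar Om a b p * Y.
Proof.
move=> [x0 Omx0] N1 HK.
have ab : a < b by have /andP[] := akP _ N1 _ Omx0; exact: lt_trans.
have c0 : 0 < (b - a) / 2 by lra.
(* As (b-a)/2 > 0, an infinite [Kconst] would make the product in the smallness condition +oo. *)
have Kfin : Kconst Om p ((a + b) / 2) \is a fin_num.
  rewrite ge0_fin_numE ?Kconst_ge0// ltNge leye_eq; apply/negP => /eqP Ky.
  by move: HK; rewrite Ky gt0_muley ?lte_fin.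
have := Kconst_bound t0 N1 Kfin (@source_Lp _) (frozen_source_solution _).
have mc k x : (k < N)%N -> Om x -> `|(a + b) / 2 - ak k.+1 x| <= (b - a) / 2.
  by move=> kN Omx; have := akP _ kN _ Omx; rewrite ler_norml => /andP[? ?]; lra.
have := source_norm_le (ltW c0) mc.
move: HK; rewrite /Dbar -{1}(fineK Kfin) -EFinM lte_fin -/X.
have : 0 <= fine (Kconst Om p ((a + b) / 2)) by rewrite fine_ge0// Kconst_ge0.
move: (fine _) (weighted_norm _ _ _ _) c0 => K Z; set c := (b - a) / 2 => c0 K0 cK ZY XZ.
have den : 0 < 1 - c * K by lra.
rewrite mulrAC ler_pdivlMr//.
(* Together with X <= K Z this gives (1 - c K) X <= K Y. *)
have : K * Z <= K * (Y + c * X) by rewrite ler_wpM2l.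
lra.
Qed.

Lemma step_bound {k} : 0 <= b -> (k < N)%N ->
  nrm (Psi k) <= nrm (Psi k.+1) +
    tau * (nrm (F k.+1) + b * nrm (laplacian Om (Psi k))).
Proof.
move=> b0 kN.
have decrLp := in_Lp_comb Om p1 (-1) (PsiLp kN) (PsiLp (ltnW kN)).
have := rnormD Om p1 _ _ (PsiLp kN) decrLp.
rewrite (_ : (fun x => _) = Psi k); last by apply/funext => x; ring.
move=> /le_trans; apply; rewrite lerD2l.
have Hle : nrm (frozen_source 0 k.+1) <=
    nrm (F k.+1) + b * nrm (laplacian Om (Psi k)).
  apply: frozen_source_le => // x Omx; rewrite sub0r normrN.
  have /andP[ax xb] := akP _ kN _ Omx.
  by rewrite ger0_norm ltW// (lt_trans a0).
apply: le_trans (ler_wpM2l (ltW t0) Hle).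
apply: le_rnorm => //; [exact: ltW|exact: source_Lp|].
apply: filterE => x _; rewrite -{1}(gtr0_norm t0) -normrM.
rewrite /frozen_source/= mul0r addr0 (mulrC tau) divfK ?gt_eqF//.
by rewrite -normrN opprD mulN1r opprK.
Qed.

Lemma Psi0_bound (p' : R) : 0 <= b -> 0 < p' -> p^-1 + p'^-1 = 1 ->
  nrm (Psi 0%N) <= (N%:R * tau) `^ p'^-1 * (Y + b * X).
Proof.
move=> b0 p'0 pp'.
pose f k := nrm (F k.+1) + b * nrm (laplacian Om (Psi k)).
have f0 k : 0 <= f k by rewrite addr_ge0 ?mulr_ge0 ?rnorm_ge0.
(* Induction runs from time 0 up to [N], where the terminal condition removes the remaining norm. *)
have telescope n : (n <= N)%N ->
    nrm (Psi 0%N) <= nrm (Psi n) + \sum_(k < n) tau * f k.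
  elim: n => [|n ih] nN; first by rewrite big_ord0 addr0.
  apply: (le_trans (ih (ltnW nN))); rewrite big_ord_recr/=.
  have : nrm (Psi n) <= nrm (Psi n.+1) + tau * f n := step_bound b0 nN.
  lra.
(* [le_rnorm] compares Psi^N with itself, with constant 0. *)
have PsiN0 : nrm (Psi N) <= 0.
  rewrite -(mul0r (nrm (Psi N))).
  apply: le_rnorm => //; [exact: PsiLp|exact: PsiLp|].
  have [_ _ + _] := sol; apply: filterS => x PsiN Omx.
  by rewrite PsiN// normr0 mulr0.
have := telescope N (leqnn N).
have := sum_le_weighted_norm N p p' tau f p0 p'0 pp' t0 (fun k _ => f0 k).
have : weighted_norm N p tau f <= Y + b * X.
  rewrite /X -weighted_normZ// => [|k kN]; last exact: rnorm_ge0.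
  by apply: weighted_normD => // k kN; rewrite ?mulr_ge0 ?rnorm_ge0.
move=> /(ler_wpM2l (powR_ge0 (N%:R * tau) p'^-1)); lra.
Qed.

End solution.

Theorem lemma12 (R : realType) (d : nat) (Om : set 'rV[R]_d.+1)
  (HOm : smooth_bounded_domain Om)
  (N : nat) (HN : (1 <= N)%N) (tau : R) (Htau : 0 < tau)
  (a b : R) (Ha : 0 < a) (ak : nat -> 'rV[R]_d.+1 -> R)
  (Hsmooth : forall k, (k < N)%N -> smooth_on Om (ak k.+1))
  (Hak : forall k, (k < N)%N -> forall x, Om x -> a < ak k.+1 x < b)
  (p p' : R) (Hp : 1 < p) (Hpp' : p^-1 + p'^-1 = 1)
  (HK : (((b - a) / 2)%:E * Kconst Om p ((a + b) / 2) < 1)%E)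
  (F : nat -> 'rV[R]_d.+1 -> R)
  (HF : forall k, (k < N)%N -> in_Lp Om p (F k.+1))
  (Psi : nat -> 'rV[R]_d.+1 -> R)
  (HPsi : is_solution Om p ak tau N F Psi) :
  (discrete_LpLp_norm Om p tau N (fun k => laplacian Om (Psi k)) <=
     (Dbar Om a b p)%:E * discrete_LpLp_norm Om p tau N (fun k => F k.+1))%E /\
  (Lp_norm Om p (Psi 0%N) <=
     ((1 + b * Dbar Om a b p) * (N%:R * tau) `^ p'^-1)%:E *
     discrete_LpLp_norm Om p tau N (fun k => F k.+1))%E.
Proof.
have p1 : 1 <= p := ltW Hp.
have p'0 : 0 < p'.
  by rewrite -invr_gt0 (_ : p'^-1 = 1 - p^-1) ?subr_gt0 ?invf_lt1 ?(lt_trans ltr01)//; lra.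
have [_ _ [x0 Omx0] _ _] := HOm.
have ab : a < b by have /andP[] := Hak _ HN _ Omx0; exact: lt_trans.
have b0 : 0 <= b by lra.
have XY := laplacian_bound p1 Htau Hak HF HPsi (ex_intro _ x0 Omx0) HN HK.
have [W _ _ _] := HPsi.
(* All functions involved lie in L^p, so the extended-real norms become real ones. *)
rewrite (discrete_LpLp_normE Om) => [|k kN]; last first.
  by apply: in_Lp_laplacian => //; exact: W _ (ltnW kN).
rewrite (discrete_LpLp_normE Om)// -EFinM lee_fin; split=> //.
have [PsiLp _] := W _ (leq0n N).
rewrite (rnormE Om)// -EFinM lee_fin.
apply: (le_trans (Psi0_bound p1 Ha Htau Hak HF HPsi p' b0 p'0 Hpp')).
(* It remains to see Y + b X <= (1 + b D) Y, which is [XY] multiplied by b >= 0. *)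
rewrite (mulrC (1 + _)) -mulrA ler_wpM2l ?powR_ge0//.
by rewrite mulrDl mul1r lerD2l -mulrA ler_wpM2l.
Qed.
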